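(* Let $\ell_{\min}$ be a real-valued observable, and let $\rho_0$ and $\rho_1$ denote its probability densities under the hypotheses $H_0$ and $H_1$ respectively. Define the cumulative ROC by $$TPR_{cum}(\tau)=\mathbb{P}_{\ell_{\min}\sim\rho_0}[\ell_{\min}<\tau],\qquad FPR_{cum}(\tau)=\mathbb{P}_{\ell_{\min}\sim\rho_1}[\ell_{\min}<\tau],$$ and the Neyman–Pearson ROC by $$TPR_{NP}(C)=\mathbb{P}_{\ell_{\min}\sim\rho_0}\big[\rho_0(\ell_{\min})>C\rho_1(\ell_{\min})\big],\qquad FPR_{NP}(C)=\mathbb{P}_{\ell_{\min}\sim\rho_1}\big[\rho_0(\ell_{\min})>C\rho_1(\ell_{\min})\big],\quad C\ge 0.$$ Assume there exists a strictly increasing differentiable transformation $\Phi$ (defined on the range of $\ell_{\min}$, with values in $\mathbb{R}$) such that $\Phi(\ell_{\min})\sim\mathcal{N}(\mu_0,\sigma_0^2)$ if $\ell_{\min}\sim\rho_0$ and $\Phi(\ell_{\min})\sim\mathcal{N}(\mu_1,\sigma_1^2)$ if $\ell_{\min}\sim\rho_1$, with $\mu_0<\mu_1$. Then the Neyman–Pearson ROC is asymptotically equivalent to the cumulative ROC at low $FPR$: the cumulative ROC is the curve $$TPR=g(FPR):=\tfrac12-\tfrac12\,\mathrm{erf}\!\left(\frac{\mu_0-\mu_1}{\sqrt2\,\sigma_0}+\frac{\sigma_1}{\sigma_0}\,\mathrm{erf}^{-1}(1-2FPR)\right),$$ and $g\big(FPR_{NP}(C)\big)/TPR_{NP}(C)\to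 1$ as $C\to\infty$ (the low-$FPR$ limit).
   Context: $\mathrm{erf}$ denotes the Gaussian error function and $\mathrm{erf}^{-1}$ its inverse. In the paper's application, $\ell_{\min}=\min_{Z\in\mathcal{D}_N}\ell(Z,\mathcal{R}(\theta))\in[0,1]$ is the minimal normalized reconstruction error between a reconstruction $\mathcal{R}(\theta)$ and the elements of a training set $\mathcal{D}_N$; under $H_0$ the weights $\theta$ were trained on $\mathcal{D}_N$, under $H_1$ on an independent training set. ''Asymptotically equivalent at low FPR'' is made precise in the claim as the ratio limit.
   Formalization: The limit is taken only over C with TPR_NP(C) nonzero: if σ1 > σ0 the likelihood ratio is bounded, so for large C the ratio is 0/0 and the claim is undefined (vacuous here). The range of ℓ_min is taken to be an interval, and erf^{-1}(±1) = ±∞. *)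

(* Defs.v *)
From HB Require Import structures.
From mathcomp Require Import all_boot all_order all_algebra.
From mathcomp Require Import all_classical all_reals all_analysis.
Set Implicit Arguments. Unset Strict Implicit. Unset Printing Implicit Defensive.
Import Order.TTheory GRing.Theory Num.Def Num.Theory.
Local Open Scope classical_set_scope.
Local Open Scope ring_scope.

Section Defs.
Context {R : realType}.

Definition erf (x : R) : R :=
  2 / Num.sqrt pi *
  (if 0 <= x then Rintegral lebesgue_measure `[0, x] (fun t => expR (- t ^+ 2))
   else - Rintegral lebesgue_measure `[x, 0] (fun t => expR (- t ^+ 2))).

Definition erfE (x : \bar R) : R :=
  match x with
  | r%:E => erf r
  | +oo%E => 1
  | -oo%E => -1
  end.

Definition erfinv (z : R) : \bar R :=
  if (-1 < z) && (z < 1) then (xget 0 [set y | erf y = z])%:E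
  else if 1 <= z then +oo%E else -oo%E.

Definition roc_g (mu0 mu1 s0 s1 : R) (fpr : R) : R :=
  2^-1 - 2^-1 * erfE (((mu0 - mu1) / (Num.sqrt 2 * s0))%:E
                      + (s1 / s0)%:E * erfinv (1 - 2 * fpr))%E.

(* probability that l_min lies in A when l_min has density rho on its range D *)
Definition prob_dens (D : set R) (rho : R -> R) (A : set R) : R :=
  fine (\int[lebesgue_measure]_(x in D `&` A) (rho x)%:E)%E.

Definition TPR_cum D (rho0 : R -> R) (tau : R) := prob_dens D rho0 [set x | x < tau].
Definition FPR_cum D (rho1 : R -> R) (tau : R) := prob_dens D rho1 [set x | x < tau].
Definition NP_region (rho0 rho1 : R -> R) (C : R) := [set x | rho0 x > C * rho1 x].
Definition TPR_NP D (rho0 rho1 : R -> R) (C : R) := prob_dens D rho0 (NP_region rho0 rho1 C).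
Definition FPR_NP D (rho0 rho1 : R -> R) (C : R) := prob_dens D rho1 (NP_region rho0 rho1 C).

Definition pushforward_normal (D : set R) (rho Phi : R -> R) (mu s : R) : Prop :=
  forall B : set R, measurable B ->
    (\int[lebesgue_measure]_(x in D `&` (Phi @^-1` B)) (rho x)%:E)%E = normal_prob mu s B.

End Defs.

(* Main.v *)
Require Import Defs.
From HB Require Import structures.
From mathcomp Require Import all_boot all_order all_algebra.
From mathcomp Require Import all_classical all_reals all_analysis.
From mathcomp Require Import measurable_realfun ring lra.
Import Order.TTheory GRing.Theory Num.Def Num.Theory.
Import numFieldNormedType.Exports.
Local Open Scope classical_set_scope.
Local Open Scope ring_scope.
Set Implicit Arguments.
Unset Strict Implicit.

(** Pushing forward by Phi, every Borel subset of D is the trace of the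
    preimage of a Borel set B, because Phi is strictly increasing. Hence all
    probabilities are Gaussian ones: the cumulative ROC becomes the ROC of the
    rays ]-oo, t[, and the Neyman-Pearson region corresponds to a Borel set B
    that inherits the optimality inequalities P0 >= C P1 inside B and
    P0 <= C P1 outside B.

    Let ]-oo, t'[ be the ray with P1 ]-oo, t'[ = P1 B, so that
    g(FPR_NP) = P0 ]-oo, t'[. The Neyman-Pearson lemma gives
    P0 ]-oo, t'[ <= P0 B. Conversely, up to a null set B is the set where the
    log-likelihood ratio, a quadratic polynomial q, exceeds a large level.
    - If s0 < s1, q is bounded above and B is null for large C.
    - If s0 = s1, B is a ray.
    - If s1 < s0, B is the union of ]-oo, c - r[ and ]c + r, +oo[, where the
      vertex c of q lies to the right of mu0; reflecting through c shows that
      the upper tail is negligible with respect to the lower one for P0.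
    In the last two cases B contains a ray ]-oo, t[ carrying a fraction of at
    least 1 / (1 + e) of P0 B, and t <= t' because
    P1 ]-oo, t[ <= P1 B = P1 ]-oo, t'[. *)

(** * The Gaussian distribution function in terms of [erf] *)

Section gaussian_cdf.
Context {R : realType}.
Notation mu := (@lebesgue_measure R).
Implicit Types (m s t u : R).

(** Half of the full integral lies to the left of 0; the piece between 0 and [u] is then added or
    subtracted, matching the two branches of [erf]. *)
Lemma Rintegral_gaussNy u :
  \int[mu]_(x in `]-oo, u]) gauss_fun x = Num.sqrt pi / 2 * (1 + erf u).
Proof.
have intg (A : set R) : measurable A -> mu.-integrable A (EFin \o gauss_fun).
  by move=> mA; apply: (integrableS _ _ (subsetT _)) => //; exact: integrableT_gauss.
have spi0 : Num.sqrt pi != 0 :> R by rewrite sqrtr_eq0 -ltNge pi_gt0.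
have half : \int[mu]_(x in `]-oo, 0]) gauss_fun x = Num.sqrt pi / 2.
  rewrite /Rintegral -[RHS](_ : fine (Num.sqrt pi / 2)%:E = _)//.
  rewrite -integral0y_gauss ge0_integration_by_substitution0//.
  - by congr fine; apply: eq_integral => x _; rewrite /gauss_fun sqrrN.
  - by apply/measurable_EFinP; exact: measurable_gauss_fun.
  - by move=> r; rewrite lee_fin gauss_fun_ge0.
rewrite /erf -/(gauss_fun) -/mu.
have [u0|u0] := leP 0 u.
  have := @Rintegral_itvB R gauss_fun -oo%O (BRight u) 0 (intg _ _).
  rewrite half => /(_ _ _ _)/(canRL (subrK _)) -> //.
  rewrite Rintegral_itv_obnd_cbnd; last exact: intg.
  by rewrite /gauss_fun; field.
have := @Rintegral_itvB R gauss_fun -oo%O (BRight 0) u (intg _ _).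
rewrite half => /(_ _ _ _).
rewrite Rintegral_itv_obnd_cbnd; last exact: intg.
have -> : \int[mu]_(x in `[u, 0]) gauss_fun x =
  \int[mu]_(x in `[u, 0]) expR (- x ^+ 2) by [].
move=> <- //; first by field.
by rewrite bnd_simp ltW.
Qed.

Lemma normal_prob_ray m s t : 0 < s ->
  normal_prob m s `]-oo, t[ =
  (2^-1 + 2^-1 * erf ((t - m) / (Num.sqrt 2 * s)))%:E.
Proof.
move=> s0; have s_neq0 : s != 0 by rewrite gt_eqF.
set k := Num.sqrt 2 * s.
have k0 : 0 < k by rewrite mulr_gt0// sqrtr_gt0.
have kne : k != 0 by rewrite gt_eqF.
have k2 : k ^+ 2 = s ^+ 2 *+ 2.
  by rewrite /k exprMn sqr_sqrtr// mulrC mulr_natr.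
(* The factor [Num.sqrt 2] in [k] absorbs the 2 in the exponent of the density, so this substitution
   leads to [gauss_fun] itself. *)
pose F x := (x - m) / k.
have F'E : F^`()%classic = cst k^-1.
  apply/funext => x; rewrite /F derive1E deriveM// deriveD// derive_cst scaler0.
  by rewrite add0r derive_id derive_cst addr0 scaler1.
have spi : Num.sqrt pi != 0 :> R by rewrite sqrtr_eq0 -ltNge pi_gt0.
have peakE : normal_peak s = (Num.sqrt pi)^-1 * k^-1.
  rewrite /normal_peak (_ : s ^+ 2 * pi *+ 2 = pi * k ^+ 2); last by rewrite k2; ring.
  by rewrite sqrtrM ?pi_ge0// sqrtr_sqr gtr0_norm// invfM.
have pdfE x : normal_pdf m s x = (Num.sqrt pi)^-1 * (gauss_fun (F x) * k^-1).
  rewrite normal_pdfE// peakE /normal_fun /gauss_fun /F exprMn exprVn k2.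
  by rewrite mulNr; ring.
rewrite /normal_prob integral_itv_bndo_bndc; last first.
  by apply/measurable_EFinP/measurable_funTS; exact: measurable_normal_pdf.
under eq_integral do rewrite pdfE EFinM.
have mgF : measurable_fun [set: R] (gauss_fun \o F).
  apply: measurableT_comp; first exact: measurable_gauss_fun.
  by apply: measurable_funM => //; exact: measurable_funD.
rewrite ge0_integralZl_EFin//; last 2 first.
- by move=> x _; rewrite lee_fin mulr_ge0 ?gauss_fun_ge0// invr_ge0 ltW.
- by apply/measurable_EFinP/measurable_funTS; apply: measurable_funM.
have -> : (\int[mu]_(x in `]-oo, t]) (gauss_fun (F x) * k^-1)%:E =
    \int[mu]_(x in `]-oo, t]) (((gauss_fun \o F) * F^`()%classic) x)%:E)%E.
  by apply: eq_integral => x _; rewrite F'E.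
rewrite -increasing_ge0_integration_by_substitutionNy//; last 8 first.
- by move=> x y _ _ xy; rewrite /F ltr_pM2r ?invr_gt0// ltrD2r.
- by rewrite F'E => ? _; exact: cvg_cst.
- by rewrite F'E; exact: is_cvg_cst.
- by rewrite F'E; exact: cvg_cst.
- split.
    by move=> x _; rewrite /F; apply: derivableM => //; apply: derivableD.
  apply: cvg_at_left_filter; rewrite /F; apply: cvgM; last exact: cvg_cst.
  by apply: cvgB; [exact: cvg_id|exact: cvg_cst].
- by apply/gt0_cvgMlNy; [rewrite invr_gt0|exact: cvg_addrr_Ny].
- by apply: continuous_subspaceT; exact: continuous_gauss_fun.
- by move=> x _; exact: gauss_fun_ge0.
rewrite -(@fineK _ (\int[mu]_(x in `]-oo, F t]) _)%E); last first.
  apply: integrable_fin_num => //.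
  by apply: (integrableS _ _ (subsetT _)) => //; exact: integrableT_gauss.
rewrite -[X in (_ * X%:E)%E]/(\int[mu]_(x in `]-oo, F t]) gauss_fun x).
by rewrite Rintegral_gaussNy -EFinM; congr EFin; field.
Qed.

End gaussian_cdf.

(** The difference [g - f] is nonnegative with integral at most 0, so it vanishes almost everywhere
    on [N]; yet it vanishes nowhere on [N]. *)
Lemma integral_lt_null d (T : measurableType d) (R : realType)
    (mu : {measure set T -> \bar R}) (N : set T) (f g : T -> R) :
  measurable N -> mu.-integrable N (EFin \o f) -> mu.-integrable N (EFin \o g) ->
  (forall x, N x -> f x < g x) ->
  (\int[mu]_(x in N) (g x)%:E <= \int[mu]_(x in N) (f x)%:E)%E ->
  mu N = 0%E.
Proof.
move=> mN intf intg fg ile.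
have intfg := integrableB mN intg intf.
have mfg := measurable_int _ intfg.
have gf0 x : N x -> (0 <= (g x)%:E - (f x)%:E)%E.
  by move=> /fg fgx; rewrite -EFinB lee_fin subr_ge0 ltW.
have : (\int[mu]_(x in N) `|(g x)%:E - (f x)%:E| = 0)%E.
  rewrite (@eq_integral _ _ _ _ _ (fun x => (g x)%:E - (f x)%:E)%E); last first.
    by move=> x /set_mem/gf0 h; rewrite gee0_abs.
  apply/eqP; rewrite eq_le integral_ge0// andbT.
  by rewrite integralB_EFin// sube_le0.
move/(ae_eq_integral_abs mu mN mfg) => /=.
move=> [A [mA A0 NA]]; apply: (subset_measure0 mN mA _ A0).
move=> x Nx; apply: NA => /= /(_ Nx)/eqP; rewrite -EFinB eqe subr_eq0.
by rewrite gt_eqF// fg.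
Qed.

(** * Gaussian probabilities as real numbers *)

Section nprob.
Context {R : realType}.
Notation mu := (@lebesgue_measure R).
Implicit Types (m s t c : R) (A B N : set R).

Definition nprob m s A : R := fine (normal_prob m s A).

Lemma nprobE m s A : measurable A -> normal_prob m s A = (nprob m s A)%:E.
Proof. by move=> mA; rewrite /nprob fineK// fin_num_measure. Qed.

Lemma nprob_ge0 m s A : 0 <= nprob m s A.
Proof. exact/fine_ge0/measure_ge0. Qed.

Lemma le_nprob m s A B : measurable A -> measurable B -> A `<=` B ->
  nprob m s A <= nprob m s B.
Proof.
by move=> mA mB AB; rewrite -lee_fin -!nprobE// le_measure ?inE.
Qed.

Lemma nprob_le1 m s A : measurable A -> nprob m s A <= 1.
Proof. by move=> mA; rewrite -lee_fin -nprobE// probability_le1. Qed.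

Lemma nprobDI m s A B : measurable A -> measurable B ->
  nprob m s A = nprob m s (A `\` B) + nprob m s (A `&` B).
Proof.
move=> mA mB; have mAB := measurableD mA mB.
apply: EFin_inj; rewrite EFinD -!nprobE//; last exact: measurableI.
exact: measureDI.
Qed.

Lemma nprob_ray m s t : 0 < s ->
  nprob m s `]-oo, t[ = 2^-1 + 2^-1 * erf ((t - m) / (Num.sqrt 2 * s)).
Proof. by move=> s0; rewrite /nprob normal_prob_ray. Qed.

Lemma nprob_ray_closed m s t : nprob m s `]-oo, t] = nprob m s `]-oo, t[.
Proof.
congr fine; rewrite /normal_prob integral_itv_bndo_bndc//.
by apply/measurable_EFinP/measurable_funTS; exact: measurable_normal_pdf.
Qed.

Lemma integrable_normal_pdfZ c m s A : measurable A ->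
  mu.-integrable A (fun x => (c * normal_pdf m s x)%:E).
Proof.
move=> mA; under [X in _.-integrable _ X]eq_fun do rewrite EFinM.
apply: integrableZl => //.
by apply: (integrableS _ _ (subsetT _)) => //; exact: integrable_normal_pdf.
Qed.

Lemma integral_normal_pdfZ c m s A : measurable A ->
  (\int[mu]_(x in A) (c * normal_pdf m s x)%:E = (c * nprob m s A)%:E)%E.
Proof.
move=> mA; under eq_integral do rewrite EFinM.
rewrite integralZl ?EFinM -?nprobE//.
by apply: (integrableS _ _ (subsetT _)) => //; exact: integrable_normal_pdf.
Qed.

Lemma nprob_pdf_le c m s m' s' A : measurable A ->
  (forall x, A x -> normal_pdf m s x <= c * normal_pdf m' s' x) ->
  nprob m s A <= c * nprob m' s' A.
Proof.
move=> mA le_pdf; rewrite -lee_fin -integral_normal_pdfZ// -nprobE//.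
apply: ge0_le_integral => //.
- by move=> x _; rewrite lee_fin normal_pdf_ge0.
- by apply/measurable_EFinP/measurable_funTS; exact: measurable_normal_pdf.
- by apply: (measurable_int mu); exact: integrable_normal_pdfZ.
Qed.

(** Passes from probabilities back to densities: a set on which the two orderings conflict is
    negligible. *)
Lemma nprob_pdf_lt_null c c' m s m' s' N : measurable N ->
  (forall x, N x -> c * normal_pdf m s x < c' * normal_pdf m' s' x) ->
  c' * nprob m' s' N <= c * nprob m s N -> mu N = 0%E.
Proof.
move=> mN lt_pdf le_N.
apply: (@integral_lt_null _ _ R mu N (fun x => c * normal_pdf m s x)
  (fun x => c' * normal_pdf m' s' x)) => //; try exact: integrable_normal_pdfZ.
by rewrite !integral_normal_pdfZ// lee_fin.
Qed.

Lemma nprob_null m s N : measurable N -> mu N = 0%E -> nprob m s N = 0.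
Proof.
move=> mN N0; have /null_content_dominatesP dom := normal_prob_dominates m s.
by rewrite /nprob dom.
Qed.

(** The density is positive everywhere, so an interval of probability 0 would have length 0. *)
Lemma nprob_gt0 m s a b : 0 < s -> a < b -> 0 < nprob m s `[a, b[.
Proof.
move=> s0 ab; rewrite lt_neqAle nprob_ge0 andbT; apply/negP => /eqP p0.
have : mu `[a, b[%classic = 0%E.
  apply: (@nprob_pdf_lt_null 0 1 m s m s) => //.
    move=> x _; rewrite mul0r mul1r normal_pdfE ?gt_eqF//.
    by rewrite mulr_gt0 ?expR_gt0// normal_peak_gt0// gt_eqF.
  by rewrite -p0 mulr0.
rewrite /= lebesgue_measure_itv/= lte_fin ab => /eqP.
by rewrite -EFinB eqe subr_eq0 gt_eqF.
Qed.

Lemma nprob_rayB m s a b : a <= b ->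
  nprob m s `]-oo, b[ = nprob m s `]-oo, a[ + nprob m s `[a, b[.
Proof.
move=> ab; rewrite (nprobDI m s (B := `]-oo, a[))// addrC; congr (_ + _).
  congr nprob; apply/seteqP; split => x /=; rewrite !in_itv/=; first by case.
  by move=> xa; split => //; exact: lt_le_trans ab.
congr nprob; apply/seteqP; split => x /=; rewrite !in_itv/=.
  by case=> xb /negP; rewrite -leNgt => ->.
by move=> /andP[ax xb]; split => //; apply/negP; rewrite -leNgt.
Qed.

Lemma nprob_ray_lt m s a b : 0 < s -> a < b ->
  nprob m s `]-oo, a[ < nprob m s `]-oo, b[.
Proof.
by move=> s0 ab; rewrite (nprob_rayB _ _ (ltW ab)) ltrDl nprob_gt0.
Qed.

Lemma nprob_ray_bounds m s t : 0 < s -> 0 < nprob m s `]-oo, t[ < 1.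
Proof.
move=> s0; apply/andP; split.
  by apply: le_lt_trans (nprob_ge0 m s `]-oo, t - 1[) _; rewrite nprob_ray_lt// gtrBl.
apply: (@lt_le_trans _ _ (nprob m s `]-oo, t + 1[)); last exact: nprob_le1.
by rewrite nprob_ray_lt// ltrDl.
Qed.

Lemma nprob_itv_le m s a b : 0 < s -> a <= b ->
  nprob m s `[a, b[ <= normal_peak s * (b - a).
Proof.
move=> s0 ab; rewrite -lee_fin -nprobE//.
apply: (@le_trans _ _ (\int[mu]_(x in `[a, b[) (normal_peak s)%:E)%E).
  apply: ge0_le_integral => //.
  - by move=> x _; rewrite lee_fin normal_pdf_ge0.
  - by apply/measurable_EFinP/measurable_funTS; exact: measurable_normal_pdf.
  - by move=> x _; rewrite lee_fin normal_pdf_ub ?gt_eqF.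
rewrite integral_cst//= lebesgue_measure_itv/= lte_fin.
case: ltP => [_|ba]; first by rewrite -EFinB -EFinM.
by rewrite mule0 lee_fin mulr_ge0 ?normal_peak_ge0 ?subr_ge0.
Qed.

(** The distribution function is Lipschitz, the peak of the density being a constant for it. *)
Lemma continuous_nprob_ray m s : 0 < s ->
  continuous (fun t => nprob m s `]-oo, t[).
Proof.
move=> s0 t; have pk0 : 0 < normal_peak s by rewrite normal_peak_gt0 ?gt_eqF.
have lip x y : x <= y ->
    `|nprob m s `]-oo, y[ - nprob m s (`]-oo, x[) | <= normal_peak s * `|y - x|.
  move=> xy; rewrite (nprob_rayB _ _ xy) addrAC subrr add0r.
  by rewrite !ger0_norm ?subr_ge0 ?nprob_ge0 ?nprob_itv_le.
apply/cvgrPdist_lt => e e0; near=> x.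
apply: (@le_lt_trans _ _ (normal_peak s * `|t - x|)).
  by case: (leP x t) => [/lip//|/ltW/lip]; rewrite distrC (distrC x).
rewrite mulrC -ltr_pdivlMr//; near: x.
by apply: cvgr_dist_lt; [exact: cvg_id|rewrite divr_gt0].
Unshelve. all: by end_near. Qed.

(** The identity, seen as a random variable under [normal_prob], has the ray probabilities as its
    [cdf]; this supplies their limits at both infinities. *)
Let idTR : measurableTypeR R -> R := idfun.

#[local] HB.instance Definition _ :=
  @isMeasurableFun.Build _ _ _ _ idTR (@measurable_id _ _ setT).

Lemma nprob_ray_surj m s p : 0 < s -> 0 < p < 1 ->
  exists t, nprob m s `]-oo, t[ = p.
Proof.
move=> s0 /andP[p0 p1]; pose F t := nprob m s `]-oo, t[.
pose X : {RV normal_prob m s >-> R} := idTR.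
have FX : fine \o cdf X = F by apply/funext => t; exact: nprob_ray_closed.
have F0 : F t @[t --> -oo] --> (0:R) by rewrite -FX; exact/fine_cvg/cvg_cdfNy0.
have F1 : F t @[t --> +oo] --> (1:R) by rewrite -FX; exact/fine_cvg/cvg_cdfy1.
have [a Fa] : exists a, F a < p := filter_ex (cvgr_lt _ F0 _ p0).
have [b Fb] : exists b, p < F b := filter_ex (cvgr_gt _ F1 _ p1).
have ab : a <= b.
  rewrite leNgt; apply/negP => /(nprob_ray_lt m s0) /ltW ba.
  by have := lt_trans Fa (lt_le_trans Fb ba); rewrite ltxx.
have cF : {within `[a, b], continuous F}.
  by apply: continuous_subspaceT; exact: continuous_nprob_ray.
have [|c _ Fc] := IVT (v := p) ab cF; last by exists c.
by rewrite ge_min le_max (ltW Fa) (ltW Fb) orbT.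
Qed.

End nprob.

(** * Properties of [erf], its inverse, and the curve [roc_g] *)

Section erf.
Context {R : realType}.
Notation mu := (@lebesgue_measure R).
Implicit Types x y z : R.

(** Through the standard normal law, [erf] inherits the bounds and the strict monotonicity of a
    distribution function. *)
Lemma erfE_nprob x : erf x = 2 * nprob 0 1 `]-oo, Num.sqrt 2 * x[ - 1.
Proof.
rewrite nprob_ray// subr0 mulr1 [X in erf (X / _)]mulrC mulfK; first by field.
by rewrite gt_eqF// sqrtr_gt0.
Qed.

Lemma erf_bounds x : -1 < erf x < 1.
Proof.
rewrite erfE_nprob; have := @nprob_ray_bounds R 0 1 (Num.sqrt 2 * x) ltr01.
by move=> /andP[h0 h1]; apply/andP; split; lra.
Qed.

Lemma erf_lt x y : x < y -> erf x < erf y.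
Proof.
move=> xy; rewrite !erfE_nprob ltrD2r ltr_pM2l// nprob_ray_lt//.
by rewrite ltr_pM2l// sqrtr_gt0.
Qed.

Lemma erf_inj : injective (@erf R).
Proof.
move=> x y exy; apply/eqP; rewrite eq_le !leNgt; apply/andP.
by split; apply/negP => /erf_lt; rewrite exy ltxx.
Qed.

Lemma erfN x : erf (- x) = - erf x.
Proof.
wlog x0 : x / 0 < x.
  move=> h; case: (ltgtP x 0) => [x0|/h//|->].
    by rewrite -[in RHS](opprK x) [in RHS]h ?opprK// oppr_gt0.
  by rewrite oppr0 /erf lexx set_itv1 Rintegral_set1 mulr0 oppr0.
rewrite /erf (ltW x0) oppr_ge0 leNgt x0/= mulrN; congr (- (_ * _)).
rewrite /Rintegral -{1}oppr0 integration_by_substitution_oppr//; last 2 first.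
- exact: ltW.
- by apply: continuous_subspaceT; exact: continuous_gauss_fun.
by congr fine; apply: eq_integral => t _ /=; rewrite sqrrN.
Qed.

Lemma erfinvK x : erfinv (erf x) = x%:E.
Proof.
rewrite /erfinv erf_bounds; congr EFin; apply: erf_inj.
exact: (xgetPex 0 (ex_intro [set y | erf y = erf x] x erefl)).
Qed.

(** By oddness [1 - 2 * FPR] is [erf (- u)], and the affine map inside [roc_g] changes
    standardization by [mu1], [s1] into standardization by [mu0], [s0]. *)
Lemma roc_g_ray (mu0 mu1 s0 s1 t : R) : 0 < s0 -> 0 < s1 ->
  roc_g mu0 mu1 s0 s1 (nprob mu1 s1 `]-oo, t[) = nprob mu0 s0 `]-oo, t[.
Proof.
move=> s0_gt0 s1_gt0; rewrite /roc_g !nprob_ray//.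
set u := (t - mu1) / _.
have -> : 1 - 2 * (2^-1 + 2^-1 * erf u) = erf (- u) by rewrite erfN; field.
rewrite erfinvK -EFinM -EFinD /=.
have -> : (mu0 - mu1) / (Num.sqrt 2 * s0) + s1 / s0 * - u =
    - ((t - mu0) / (Num.sqrt 2 * s0)).
  by rewrite /u; field; rewrite !gt_eqF// sqrtr_gt0.
by rewrite erfN mulrN opprK.
Qed.

(* Here erfinv 1 = +oo and erfE +oo = 1. *)
Lemma roc_g0 (mu0 mu1 s0 s1 : R) : 0 < s0 -> 0 < s1 ->
  roc_g mu0 mu1 s0 s1 0 = 0.
Proof.
move=> s0_gt0 s1_gt0; rewrite /roc_g mulr0 subr0 /erfinv ltxx andbF lexx.
by rewrite gt0_muley ?lte_fin ?divr_gt0//= mulr1 subrr.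
Qed.

(** The other endpoint: [erfinv (-1)] is [-oo], which [erfE] sends to -1. *)
Lemma roc_g1 (mu0 mu1 s0 s1 : R) : 0 < s0 -> 0 < s1 ->
  roc_g mu0 mu1 s0 s1 1 = 1.
Proof.
move=> s0_gt0 s1_gt0; rewrite /roc_g mulr1 /erfinv.
rewrite (_ : 1 - 2 = -1 :> R); last by ring.
have -> : (1 <= -1 :> R) = false by apply/negbTE; rewrite -ltNge; lra.
rewrite ltxx/=.
rewrite gt0_muleNy ?lte_fin ?divr_gt0//=; lra.
Qed.

End erf.

(** * Borel sets transported by a strictly increasing map on an interval *)

Section increasing_on_interval.
Context {R : realType} (D : set R) (Phi : R -> R).
Hypothesis itvD : is_interval D.
Hypothesis incPhi : {in D &, forall x y, x < y -> Phi x < Phi y}.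

Let incPhiP x y : D x -> D y -> (Phi x < Phi y) = (x < y).
Proof.
move=> Dx Dy; apply/idP/idP; last by apply: incPhi; rewrite inE.
move=> Pxy; rewrite ltNge le_eqVlt; apply/negP => /predU1P[yx|/incPhi].
  by rewrite yx ltxx in Pxy.
by rewrite !inE => /(_ Dy Dx)/(lt_trans Pxy); rewrite ltxx.
Qed.

(** The preimage of a left ray is order-convex, hence an interval. *)
Lemma increasing_measurable_fun : measurable_fun D Phi.
Proof.
apply: (measurability (@RGenInftyO.G R)) => [|/= _ [_] [r] -> <-].
  exact: RGenInftyO.measurableE.
apply: is_interval_measurable => x y /= [Dx Px] [Dy Py] z /andP[xz zy].
have Dz : D z by apply: (itvD Dx Dy); rewrite xz.
split=> //; move: Py; rewrite /= !in_itv/=; apply: le_lt_trans.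
by rewrite leNgt incPhiP// -leNgt.
Qed.

Lemma ray_preimage_increasing x : D x ->
  D `&` `]-oo, x[ = D `&` Phi @^-1` `]-oo, Phi x[.
Proof.
by move=> Dx; apply/seteqP; split=> y [Dy /=]; rewrite !in_itv/= ?incPhiP.
Qed.

Lemma ray_notin_interval x : ~ D x ->
  D `&` `]-oo, x[ = set0 \/ D `&` `]-oo, x[ = D.
Proof.
move=> nDx; have [|/set0P[y [Dy]]] := eqVneq (D `&` `]-oo, x[) set0; first by left.
rewrite /= in_itv/= => yx; right; apply/seteqP; split=> z; first by case.
move=> Dz; split=> //=; rewrite in_itv/= ltNge; apply/negP => xz; apply: nDx.
by apply: (itvD Dy Dz); rewrite xz ltW.
Qed.

(** The sets [E] with this property form a sigma-algebra, so it suffices to treat the generating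
    rays. A ray with endpoint in [D] corresponds to a ray; any other cuts [D] trivially. *)
Lemma borel_preimage_increasing (E : set R) : measurable E ->
  exists2 B : set R, measurable B & D `&` E = D `&` Phi @^-1` B.
Proof.
pose H : set (set R) := [set E | exists2 B : set R, measurable B &
  D `&` E = D `&` Phi @^-1` B].
suff : <<s @RGenInftyO.G R >> `<=` H.
  move=> sub mE; apply: sub; change ((@RGenInftyO.G R).-sigma.-measurable E).
  by rewrite -RGenInftyO.measurableE.
apply: smallest_sub; first split.
- by exists set0 => //; rewrite preimage_set0.
- move=> A [B mB AB]; exists (~` B); first exact: measurableC.
  rewrite setTD preimage_setC.
  apply/seteqP; split=> y [Dy nAy]; split=> // ?; apply: nAy.
    by have [] : (D `&` A) y by rewrite AB.
  by have [] : (D `&` Phi @^-1` B) y by rewrite -AB.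
- move=> A /(_ _)/cid2-/all_sig2[B mB AB]; exists (\bigcup_k B k).
    exact: bigcup_measurable.
  rewrite preimage_bigcup !setI_bigcupr.
  by apply: eq_bigcupr => k _; exact: AB.
move=> _ [x ->].
have [Dx|nDx] := pselect (D x).
  by exists `]-oo, Phi x[%classic => //; exact: ray_preimage_increasing.
rewrite /H/=; have [->|->] := ray_notin_interval nDx.
  by exists set0 => //; rewrite preimage_set0 setI0.
by exists setT => //; rewrite preimage_setT setIT.
Qed.

End increasing_on_interval.

(** Integrating the pointwise inequality over [D] intersected with the preimage of [S] gives
    Gaussian probabilities by the pushforward hypotheses, so no density of the image laws has to be
    computed from [Phi]. *)
Lemma pushforward_normal_le (R : realType) (D : set R) (rho rho' Phi : R -> R)
    (m s m' s' c c' : R) (S : set R) :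
  measurable D -> measurable_fun D rho -> measurable_fun D rho' ->
  (forall x, D x -> 0 <= rho x) -> (forall x, D x -> 0 <= rho' x) ->
  pushforward_normal D rho Phi m s -> pushforward_normal D rho' Phi m' s' ->
  measurable S -> measurable (D `&` Phi @^-1` S) -> 0 <= c -> 0 <= c' ->
  (forall x, D x -> S (Phi x) -> c * rho x <= c' * rho' x) ->
  c * nprob m s S <= c' * nprob m' s' S.
Proof.
move=> mD mrho mrho' rho0 rho'0 push push' mS mDS c0 c'0 le_rho.
have mr : measurable_fun (D `&` Phi @^-1` S) rho.
  by apply: (measurable_funS mD _ mrho) => x [].
have mr' : measurable_fun (D `&` Phi @^-1` S) rho'.
  by apply: (measurable_funS mD _ mrho') => x [].
rewrite -lee_fin !EFinM -!nprobE// -push// -push'//.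
rewrite -!ge0_integralZl_EFin//; last 4 first.
- by move=> x [/rho'0].
- exact/measurable_EFinP.
- by move=> x [/rho0].
- exact/measurable_EFinP.
apply: ge0_le_integral => //.
- by move=> x [/rho0 r0 _]; rewrite -EFinM lee_fin mulr_ge0.
- by apply/measurable_EFinP; exact: measurable_funM.
- by apply/measurable_EFinP; exact: measurable_funM.
- by move=> x [Dx Sx]; rewrite -!EFinM lee_fin le_rho.
Qed.

(** * The Neyman-Pearson lemma for two Gaussian laws *)

(* B plays the role of the Neyman-Pearson region: it is only known through the
   inequalities geB and leB, which hold for the densities up to a null set. *)
Section neyman_pearson.
Context {R : realType} (mu0 mu1 s0 s1 C : R) (B : set R).
Notation f0 := (normal_pdf mu0 s0).
Notation f1 := (normal_pdf mu1 s1).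
Notation P0 := (nprob mu0 s0).
Notation P1 := (nprob mu1 s1).
Hypothesis mB : measurable B.
Hypothesis geB : forall S, measurable S -> S `<=` B -> C * P1 S <= P0 S.
Hypothesis leB : forall S, measurable S -> S `<=` ~` B -> P0 S <= C * P1 S.

(** Removing the common part [T] and [B] share leaves two differences of equal [P1] mass; [C] times
    this mass separates their [P0] masses. *)
Lemma np_optimal T : measurable T -> P1 T = P1 B -> P0 T <= P0 B.
Proof.
move=> mT eqP1.
have mTB := measurableD mT mB; have mBT := measurableD mB mT.
have e1 := nprobDI mu1 s1 mT mB; have e1' := nprobDI mu1 s1 mB mT.
have e0 := nprobDI mu0 s0 mT mB; have e0' := nprobDI mu0 s0 mB mT.
have eqD : P1 (T `\` B) = P1 (B `\` T).
  by apply: (addIr (P1 (T `&` B))); rewrite -e1 eqP1 e1' setIC.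
rewrite e0 e0' (setIC B T) lerD2r.
apply: (@le_trans _ _ (C * P1 (T `\` B))); first by apply: leB => // x [].
by rewrite eqD; apply: geB => // x [].
Qed.

(** On the part of [B] where [f0 < C * f1], [geB] conflicts with the densities, so this part is
    null. *)
Lemma np_sub : P0 B <= P0 [set y | C * f1 y <= f0 y].
Proof.
have -> : [set y | C * f1 y <= f0 y] = ~` [set y | 1 * f0 y < C * f1 y].
  by apply/seteqP; split=> y /=; rewrite mul1r leNgt => /negP.
set N := [set _ | _]; have mN : measurable N.
  rewrite -[N]setTI; apply: measurable_fun_ltr => //;
    by apply: measurable_funM => //; exact: measurable_normal_pdf.
have mBN := measurableI _ _ mB mN.
rewrite (nprobDI _ _ mB mN) (nprob_null _ _ mBN) ?addr0.
  by apply: le_nprob; [exact: measurableD|exact: measurableC|move=> x []].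
apply: (@nprob_pdf_lt_null _ 1 C mu0 s0 mu1 s1) => //; first by move=> x [].
by rewrite mul1r; apply: geB => // x [].
Qed.

(** Dually, [leB] makes the part of [N] outside [B] null. *)
Lemma np_sup N : measurable N -> N `<=` [set y | C * f1 y < f0 y] -> P1 N <= P1 B.
Proof.
move=> mN subN; have mNB := measurableD mN mB.
rewrite (nprobDI _ _ mN mB) (nprob_null _ _ mNB) ?add0r.
  by apply: le_nprob => //; exact: measurableI.
apply: (@nprob_pdf_lt_null _ C 1 mu1 s1 mu0 s0) => //.
  by move=> x [/subN]; rewrite mul1r.
by rewrite mul1r; apply: leB => // x [].
Qed.

End neyman_pearson.

(** * Reflection of Gaussian laws and comparison of the two tails *)

Section reflection.
Context {R : realType}.
Notation mu := (@lebesgue_measure R).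
Implicit Types (a c m s r x : R).

(** By uniqueness it suffices to compare lengths of half-open intervals; reflection only exchanges
    their open and closed ends. *)
Lemma lebesgue_measure_reflect a (A : set R) : measurable A ->
  pushforward mu (fun x : measurableTypeR R => a - x : measurableTypeR R) A = mu A.
Proof.
have mphi : measurable_fun [set: measurableTypeR R]
    (fun x : measurableTypeR R => a - x : measurableTypeR R).
  by apply: measurable_funB.
move=> mA; apply/esym/lebesgue_measure_unique => //= _ [[x y]] _ <-.
rewrite /pushforward [X in _ = lebesgue_measure X](_ : _ = `[a - y, a - x[%classic).
  rewrite !lebesgue_measure_itv/= !lte_fin.
  have -> : (a - y < a - x) = (x < y) by apply/idP/idP => ?; lra.
  by case: ifP => // _; rewrite -!EFinB; congr EFin; ring.
by apply/seteqP; split=> z /=; rewrite !in_itv/= => /andP[? ?]; apply/andP; split; lra.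
Qed.

Lemma normal_pdf_reflect c m s x : s != 0 ->
  normal_pdf m s (2 * c - x) = normal_pdf (2 * c - m) s x.
Proof.
move=> s0; rewrite !normal_pdfE// /normal_fun.
by rewrite (_ : 2 * c - x - m = - (x - (2 * c - m))) ?sqrrN//; ring.
Qed.

Lemma nprob_reflect c m s r : s != 0 ->
  nprob m s `[c + r, +oo[ = nprob (2 * c - m) s `]-oo, c - r].
Proof.
move=> s0; pose phi (x : measurableTypeR R) : measurableTypeR R := 2 * c - x.
have mphi : measurable_fun [set: measurableTypeR R] phi by apply: measurable_funB.
congr fine; rewrite /normal_prob.
transitivity (\int[pushforward mu phi]_(x in `[(c + r)%R, +oo[) (normal_pdf m s x)%:E)%E.
  by apply: eq_measure_integral => A mA _; exact/esym/lebesgue_measure_reflect.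
rewrite ge0_integral_pushforward//; last 2 first.
- by apply/measurable_EFinP/measurable_funTS; exact: measurable_normal_pdf.
- by move=> x _; rewrite lee_fin normal_pdf_ge0.
have -> : phi @^-1` `[c + r, +oo[ = `]-oo, c - r]%classic.
  by apply/seteqP; split=> x /=; rewrite /phi !in_itv/= ?andbT => ?; lra.
by apply: eq_integral => x _ /=; rewrite /phi normal_pdf_reflect.
Qed.

(** Reflected through [c], the upper tail is a lower tail for the mean [2 * c - m]. At [x <= c - r]
    the ratio of the reflected density to the original one is the exponential of
    [- 2 * (c - m) / s ^+ 2 * (c - x)], which is largest at [x = c - r]. *)
Lemma nprob_upper_tail_le c m s r : 0 < s -> m <= c ->
  nprob m s `[c + r, +oo[ <=
    expR (- (2 * (c - m) / s ^+ 2 * r)) * nprob m s `]-oo, c - r[.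
Proof.
move=> s0 mc; rewrite nprob_reflect ?gt_eqF// -(nprob_ray_closed m).
apply: nprob_pdf_le => // x; rewrite /= in_itv/= => xcr.
rewrite !normal_pdfE ?gt_eqF// mulrCA ler_wpM2l ?normal_peak_ge0//.
rewrite /normal_fun -expRD ler_expR -subr_ge0.
have -> : - (2 * (c - m) / s ^+ 2 * r) + - (x - m) ^+ 2 / (s ^+ 2 *+ 2) -
    - (x - (2 * c - m)) ^+ 2 / (s ^+ 2 *+ 2) =
    2 * (c - m) / s ^+ 2 * (c - r - x) by field; rewrite gt_eqF.
by rewrite !mulr_ge0 ?invr_ge0 ?sqr_ge0 ?subr_ge0.
Qed.

End reflection.

(** * Superlevel sets of the Gaussian log-likelihood ratio *)

Section log_likelihood_ratio.
Context {R : realType} (mu0 mu1 s0 s1 : R).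
Hypotheses (s0_gt0 : 0 < s0) (s1_gt0 : 0 < s1) (mu01 : mu0 < mu1).
Implicit Types (C L e y t : R).

(** The log-likelihood ratio is [ln K + q y]; the level [C] for the ratio thus becomes [ln (C / K)]
    for [q]. *)
Let q y := (y - mu1) ^+ 2 / (s1 ^+ 2 *+ 2) - (y - mu0) ^+ 2 / (s0 ^+ 2 *+ 2).
Let K := normal_peak s0 / normal_peak s1.

Let s0_neq0 : s0 != 0. Proof. by rewrite gt_eqF. Qed.
Let s1_neq0 : s1 != 0. Proof. by rewrite gt_eqF. Qed.

Let K_gt0 : 0 < K.
Proof. by rewrite divr_gt0// normal_peak_gt0. Qed.

Let pdf_ratio y :
  normal_pdf mu0 s0 y = K * expR (q y) * normal_pdf mu1 s1 y.
Proof.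
rewrite !normal_pdfE// /normal_fun [RHS]mulrACA /K divfK ?gt_eqF ?normal_peak_gt0//.
by rewrite -expRD; congr (_ * expR _); rewrite /q; ring.
Qed.

Let pdf1_gt0 y : 0 < normal_pdf mu1 s1 y.
Proof. by rewrite normal_pdfE// mulr_gt0 ?expR_gt0 ?normal_peak_gt0. Qed.

Let lr_lt C y : 0 < C ->
  (C * normal_pdf mu1 s1 y < normal_pdf mu0 s0 y) = (ln (C / K) < q y).
Proof.
move=> C0; rewrite pdf_ratio ltr_pM2r// mulrC -ltr_pdivrMr//.
by rewrite -[in RHS]ltr_expR lnK// posrE divr_gt0.
Qed.

Let lr_le C y : 0 < C ->
  (C * normal_pdf mu1 s1 y <= normal_pdf mu0 s0 y) = (ln (C / K) <= q y).
Proof.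
move=> C0; rewrite pdf_ratio ler_pM2r// mulrC -ler_pdivrMr//.
by rewrite -[in RHS]ler_expR lnK// posrE divr_gt0.
Qed.

(* c is the vertex of q and a its leading coefficient. *)
Let c := (mu1 * s0 ^+ 2 - mu0 * s1 ^+ 2) / (s0 ^+ 2 - s1 ^+ 2).
Let a := (s0 ^+ 2 - s1 ^+ 2) / (2 * s0 ^+ 2 * s1 ^+ 2).

Let qE y : s0 != s1 -> q y = a * (y - c) ^+ 2 + q c.
Proof.
move=> s01; rewrite /q /a /c; field.
rewrite s0_neq0 s1_neq0 subr_eq0 eqrXn2 ?ltW//= ?andbT.
by rewrite s01.
Qed.

Let tail_dominated e : 0 < e ->
  exists L0, forall L, L0 < L -> (forall y, q y < L) \/
    exists t, (forall y, y < t -> L < q y) /\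
      nprob mu0 s0 [set y | L <= q y] <= (1 + e) * nprob mu0 s0 `]-oo, t[.
Proof.
move=> e0.
have mq L : measurable [set y | L <= q y].
  have -> : [set y | L <= q y] = [set: R] `&` [set y | cst L y <= q y].
    by rewrite setTI.
  apply: measurable_fun_le => //; rewrite /q.
  by apply: measurable_funB; apply: measurable_funM => //;
    apply: measurable_funX; apply: measurable_funB.
have den_gt0 : 0 < 2 * s0 ^+ 2 * s1 ^+ 2 by rewrite !mulr_gt0 ?exprn_gt0.
case: (ltgtP s0 s1) => s01.
(* Here [a] is not positive, so [q c] is the maximum of [q]. *)
- exists (q c) => L qL; left=> y; rewrite qE ?lt_eqF//.
  apply: le_lt_trans qL; rewrite gerDr mulr_le0_ge0 ?sqr_ge0//.
  rewrite /a pmulr_lle0 ?invr_gt0//.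
  by rewrite subr_le0 ler_pXn2r ?nnegrE ?ltW.
- have s2 : 0 < s0 ^+ 2 - s1 ^+ 2.
    by rewrite subr_gt0 ltr_pXn2r ?nnegrE ?ltW//.
  have c_gt : mu0 < c.
    rewrite /c ltr_pdivlMr// -subr_gt0.
    have -> : mu1 * s0 ^+ 2 - mu0 * s1 ^+ 2 - mu0 * (s0 ^+ 2 - s1 ^+ 2) =
      (mu1 - mu0) * s0 ^+ 2 by ring.
    by rewrite mulr_gt0 ?subr_gt0 ?exprn_gt0.
  have a_gt0 : 0 < a by rewrite /a divr_gt0.
  pose k := 2 * (c - mu0) / s0 ^+ 2.
  have k_gt0 : 0 < k by rewrite /k divr_gt0 ?exprn_gt0// mulr_gt0 ?subr_gt0.
  (* From this radius on, the tail ratio [expR (- (k * r))] is at most [e]. *)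
  pose r0 := `|ln e| / k.
  have r0_ge0 : 0 <= r0 by rewrite divr_ge0// ltW.
  exists (a * r0 ^+ 2 + q c) => L L0L; right.
  (* The solutions of [q y = L] are [c - r] and [c + r]. *)
  pose r := Num.sqrt ((L - q c) / a).
  have r0r : r0 <= r.
    rewrite -(ger0_norm r0_ge0) -sqrtr_sqr ler_sqrt; last first.
      rewrite divr_ge0 ?ltW// subr_gt0; apply: le_lt_trans L0L.
      by rewrite lerDr mulr_ge0 ?sqr_ge0 ?ltW.
    by rewrite ler_pdivlMr// mulrC lerBrDr ltW.
  have r_ge0 : 0 <= r := sqrtr_ge0 _.
  have LE : L = a * r ^+ 2 + q c.
    rewrite sqr_sqrtr; first by field; rewrite gt_eqF.
    rewrite divr_ge0 ?(ltW a_gt0)// subr_ge0 ltW//; apply: le_lt_trans L0L.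
    by rewrite lerDr mulr_ge0 ?sqr_ge0 ?ltW.
  exists (c - r); split=> [y yt|].
    rewrite qE ?gt_eqF// LE ltrD2r ltr_pM2l// -(sqrrN (y - c)) opprB.
    by rewrite ltr_pXn2r ?nnegrE//; lra.
  have sub : [set y | L <= q y] `<=` `]-oo, c - r] `|` `[c + r, +oo[.
    move=> y /=; rewrite qE ?gt_eqF// LE lerD2r ler_pM2l// !in_itv/= andbT.
    rewrite -ler_sqrt ?sqr_ge0// !sqrtr_sqr (ger0_norm r_ge0) ler_normr.
    by case/orP => ?; [right|left]; lra.
  apply: (@le_trans _ _ (nprob mu0 s0 (`]-oo, c - r] `|` `[c + r, +oo[))).
    by apply: le_nprob => //; exact: measurableU.
  apply: (@le_trans _ _ (nprob mu0 s0 `]-oo, c - r] + nprob mu0 s0 `[c + r, +oo[)).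
    by rewrite -lee_fin EFinD -!nprobE//; [exact: measureU2|exact: measurableU].
  rewrite nprob_ray_closed mulrDl mul1r lerD2l.
  apply: le_trans (nprob_upper_tail_le r s0_gt0 (ltW c_gt)) _.
  rewrite ler_wpM2r ?nprob_ge0// -/k -[leRHS](lnK _) ?posrE// ler_expR.
  rewrite lerNl; apply: (@le_trans _ _ `|ln e|); first by rewrite ler_normr lexx orbT.
  by rewrite mulrC -ler_pdivrMr.
(* With equal variances [q] is affine and decreasing, and the witness is the point where it equals
   [L]. *)
- exists 0 => L _; right; exists ((mu0 + mu1) / 2 - L * s0 ^+ 2 / (mu1 - mu0)).
  set t := (X in `]-oo, X[); have mu_gt0 : 0 < mu1 - mu0 by rewrite subr_gt0.
  have qE' y : q y = L + (mu1 - mu0) / s0 ^+ 2 * (t - y).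
    by rewrite /q /t -s01; field; rewrite s0_neq0 gt_eqF.
  have h_gt0 : 0 < (mu1 - mu0) / s0 ^+ 2 by rewrite divr_gt0 ?exprn_gt0.
  split=> [y yt|]; first by rewrite qE' ltrDl mulr_gt0 ?subr_gt0.
  rewrite (_ : [set y | L <= q y] = `]-oo, t]%classic).
    by rewrite nprob_ray_closed ler_peMl ?nprob_ge0// lerDl ltW.
  by apply/seteqP; split=> y /=; rewrite in_itv/= qE' lerDl pmulr_rge0// subr_ge0.
Qed.

Lemma likelihood_region_tail e : 0 < e -> exists M, forall C, M < C ->
  (forall y, normal_pdf mu0 s0 y < C * normal_pdf mu1 s1 y) \/
  exists t,
    `]-oo, t[ `<=` [set y | C * normal_pdf mu1 s1 y < normal_pdf mu0 s0 y] /\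
    nprob mu0 s0 [set y | C * normal_pdf mu1 s1 y <= normal_pdf mu0 s0 y] <=
      (1 + e) * nprob mu0 s0 `]-oo, t[.
Proof.
move=> /tail_dominated[L0 HL0]; exists (K * expR L0) => C MC.
have C0 : 0 < C by apply: lt_trans MC; rewrite mulr_gt0 ?expR_gt0.
have L0C : L0 < ln (C / K).
  have CK0 : 0 < C / K by rewrite divr_gt0.
  rewrite -ltr_expR lnK ?posrE//.
  by rewrite ltr_pdivlMr// mulrC.
have [qC|[t [tq le_t]]] := HL0 _ L0C; [left=> y|right; exists t; split].
- by rewrite ltNge lr_le// -ltNge.
- by move=> y /=; rewrite in_itv/= lr_lt// => /tq.
- by under eq_set do rewrite lr_le//.
Qed.

End log_likelihood_ratio.

(** * The Neyman-Pearson region in Gaussian coordinates, and the limit of the ratio *)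

Lemma NP_region_preimage (R : realType) (D : set R) (rho0 rho1 Phi : R -> R) (C : R) :
  measurable D -> is_interval D ->
  measurable_fun D rho0 -> measurable_fun D rho1 ->
  {in D &, forall x y, x < y -> Phi x < Phi y} ->
  exists2 B : set R, measurable B &
    D `&` NP_region rho0 rho1 C = D `&` Phi @^-1` B.
Proof.
move=> mD itvD mrho0 mrho1 incPhi.
have mE : measurable (D `&` NP_region rho0 rho1 C).
  rewrite (_ : _ `&` _ = D `&` [set x | (C * rho1 x)%:E < (rho0 x)%:E]%E).
    apply: measurable_lte => //; first exact/measurable_EFinP/measurable_funM.
    exact/measurable_EFinP.
  by apply/seteqP; split=> x /=; rewrite lte_fin.
have [B mB DB] := borel_preimage_increasing itvD incPhi mE.
by exists B => //; rewrite -DB setIA setIid.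
Qed.

(** If [e < 1], then [(1 - e) * y <= (1 - e) * (1 + e) * x < x]; if [1 <= e], the left side is not
    positive. *)
Lemma ratio_near1 (R : realFieldType) (e x y : R) :
  0 < e -> 0 < y -> x <= y -> y <= (1 + e) * x -> `|x / y - 1| < e.
Proof.
move=> e0 y0 xy yx; rewrite distrC ger0_norm ?subr_ge0 ?ler_pdivrMr ?mul1r//.
have x0 : 0 < x.
  have e1_gt0 : 0 < 1 + e by rewrite addr_gt0.
  by rewrite -(pmulr_rgt0 _ e1_gt0); exact: lt_le_trans yx.
rewrite ltrBlDr -ltrBlDl ltr_pdivlMr//.
have [e1|e1] := leP 1 e; first by apply: le_lt_trans x0; rewrite pmulr_lle0// subr_le0.
have : (1 - e) * y <= (1 - e) * ((1 + e) * x) by rewrite ler_wpM2l// subr_ge0 ltW.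
by move=> /le_lt_trans; apply; rewrite mulrA gtr_pMl//; nra.
Qed.

Unset Implicit Arguments.

Theorem theorem1 (R : realType) (D : set R) (rho0 rho1 Phi : R -> R)
    (mu0 mu1 s0 s1 : R) :
  measurable D -> is_interval D ->
  measurable_fun D rho0 -> measurable_fun D rho1 ->
  (forall x, D x -> 0 <= rho0 x) -> (forall x, D x -> 0 <= rho1 x) ->
  {in D &, forall x y, x < y -> Phi x < Phi y} ->
  (forall x, D x -> derivable Phi x 1) ->
  0 < s0 -> 0 < s1 -> mu0 < mu1 ->
  pushforward_normal D rho0 Phi mu0 s0 ->
  pushforward_normal D rho1 Phi mu1 s1 ->
  (* the cumulative ROC is the curve TPR = g(FPR) *)
  (forall tau : R, TPR_cum D rho0 tau = roc_g mu0 mu1 s0 s1 (FPR_cum D rho1 tau)) /\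
  (* g(FPR_NP(C)) / TPR_NP(C) -> 1 as C -> +oo (where the ratio is defined) *)
  (forall e : R, 0 < e -> exists M : R, forall C : R, M < C ->
     TPR_NP D rho0 rho1 C != 0 ->
     `| roc_g mu0 mu1 s0 s1 (FPR_NP D rho0 rho1 C) / TPR_NP D rho0 rho1 C - 1 | < e).
Proof.
move=> mD itvD mrho0 mrho1 rho0_ge0 rho1_ge0 incPhi _ s0_gt0 s1_gt0 mu01 push0 push1.
have mPhi := increasing_measurable_fun itvD incPhi.
have mDPhi (B : set R) : measurable B -> measurable (D `&` Phi @^-1` B).
  by move=> mB; exact: mPhi.
split=> [tau|e e0].
  rewrite /TPR_cum /FPR_cum -set_itvNyo.
  have [Dtau|nDtau] := pselect (D tau).
    rewrite /prob_dens (ray_preimage_increasing incPhi Dtau) push0// push1//.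
    by rewrite -/(nprob _ _ _) roc_g_ray.
  (* A threshold outside [D] gives an endpoint of the curve, (0, 0) or (1, 1). *)
  rewrite /prob_dens; have [->|->] := ray_notin_interval itvD nDtau.
    by rewrite !integral_set0/= roc_g0.
  rewrite -[D]setIT -(preimage_setT Phi) push0// push1//.
  by rewrite !probability_setT/= roc_g1.
have [M HM] := likelihood_region_tail s0_gt0 s1_gt0 mu01 e0.
(* The bound [1 < C] will force [P1 B < 1], so that a ray with the same [P1] mass as [B] exists. *)
exists (maxr 1 M) => C; rewrite gt_max => /andP[C1 /HM{}HM].
have C0 : 0 < C := lt_trans ltr01 C1.
have [B mB NPB] := NP_region_preimage C mD itvD mrho0 mrho1 incPhi.
rewrite /TPR_NP /FPR_NP /prob_dens NPB push0// push1// -!/(nprob _ _ _) => TPR_neq0.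
have inB x : D x -> (NP_region rho0 rho1 C x <-> B (Phi x)).
  move=> Dx; split=> h.
    by have [] : (D `&` Phi @^-1` B) x by rewrite -NPB.
  by have [] : (D `&` NP_region rho0 rho1 C) x by rewrite NPB.
have geB S : measurable S -> S `<=` B -> C * nprob mu1 s1 S <= nprob mu0 s0 S.
  move=> mS SB; rewrite -[leRHS]mul1r.
  apply: (pushforward_normal_le mD mrho1 mrho0 rho1_ge0 rho0_ge0 push1 push0) => //.
  - exact: mDPhi.
  - exact: ltW.
  - by move=> x Dx /SB/(inB _ Dx); rewrite mul1r => /ltW.
have leB S : measurable S -> S `<=` ~` B -> nprob mu0 s0 S <= C * nprob mu1 s1 S.
  move=> mS SB; rewrite -[leLHS]mul1r.
  apply: (pushforward_normal_le mD mrho0 mrho1 rho0_ge0 rho1_ge0 push0 push1) => //.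
  - exact: mDPhi.
  - exact: ltW.
  - move=> x Dx /SB nB; rewrite mul1r leNgt; apply/negP => h; apply: nB.
    exact/(inB _ Dx).
have P0B_gt0 : 0 < nprob mu0 s0 B by rewrite lt_neqAle eq_sym TPR_neq0 nprob_ge0.
have P0B_le := np_sub mB geB.
case: HM => [empty|[t [tsub tle]]].
  (* An empty superlevel set would make the true positive rate 0, where the ratio is undefined. *)
  exfalso; move: P0B_le; rewrite leNgt => /negP; apply.
  rewrite (_ : [set y | _] = set0); first by rewrite /nprob measure0.
  by apply/seteqP; split=> y //=; rewrite leNgt empty.
have tB : nprob mu1 s1 `]-oo, t[ <= nprob mu1 s1 B by apply: np_sup tsub.
have [t' t'E] : exists t', nprob mu1 s1 `]-oo, t'[ = nprob mu1 s1 B.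
  apply: nprob_ray_surj => //; apply/andP; split.
    by apply: lt_le_trans tB; case/andP: (nprob_ray_bounds mu1 t s1_gt0).
  (* Since [C * P1 B <= P0 B <= 1] and [1 < C], the value [P1 B] is below 1. *)
  have := geB B mB (@subset_refl _ B).
  have := nprob_le1 mu0 s0 mB.
  have := nprob_ge0 mu1 s1 B.
  nra.
have tt' : t <= t'.
  rewrite leNgt; apply/negP => /(nprob_ray_lt mu1 s1_gt0).
  by rewrite t'E ltNge tB.
rewrite -t'E roc_g_ray//; apply: ratio_near1 => //.
  exact: np_optimal mB geB leB _ _ t'E.
apply: le_trans P0B_le (le_trans tle _).
rewrite ler_wpM2l ?addr_ge0 ?ler01 ?(ltW e0)//.
apply: le_nprob => // y /=; rewrite !in_itv/= => /lt_le_trans; exact.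
Qed.
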